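(* Let $V=V_0\oplus V_1$ be a complex Lie superalgebra and let $\mathcal{G}_V$ be the associated functor, $\mathcal{G}_V(A)=(A\otimes_{\mathbb{C}}V)_0$. (1) (a) A standard real structure $\Phi$ on $\mathcal{G}_V$ comes from a unique map $\phi:V\to V$, in the sense that $\Phi_A(a\otimes v)=\bar a\otimes\phi(v)$ for every $A$ and all homogeneous $a\in A$, $v\in V$ with $|a|=|v|$, such that $$\phi(\lambda x+\mu y)=\bar\lambda\phi(x)+\bar\mu\phi(y),\qquad \phi^2(x)=x,\qquad \phi([x,y])=[\phi(x),\phi(y)]$$ for all $\lambda,\mu\in\mathbb{C}$, $x,y\in V$. (b) A graded real structure $\Phi$ on $\mathcal{G}_V$ comes from a unique map $\phi:V\to V$, in the sense that $\Phi_A(a\otimes v)=\tilde a\otimes\phi(v)$ for every $A$ and all homogeneous $a\in A$, $v\in V$ with $|a|=|v|$, such that $$\phi(\lambda x+\mu y)=\bar\lambda\phi(x)+\bar\mu\phi(y),\qquad \phi^2(x)=(-1)^{|x|}x,\qquad \phi([x,y])=[\phi(x),\phi(y)]$$ for all $\lambda,\mu\in\mathbb{C}$, $x,y\in V$ (with $x$ homogeneous in the second identity). (2) Reciprocally, a map $\phi$ on $V$ which fulfills the three identities in (a) (respectively in (b)) gives rise, by $\Phi_A(a\otimes v)=\bar a\otimes\phi(v)$ (respectively $\Phi_A(a\otimes v)=\tilde a\otimes\phi(v)$), to a standard (respectively graded) real structure $\Phi$ on $\mathcal{G}_V$.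
   Context: A superalgebra is a commutative associative (unital) superalgebra $A=A_0\oplus A_1$ over $\mathbb{C}$, where commutative means $xy=(-1)^{|x||y|}yx$ for homogeneous $x,y$. It is called reduced if $A/\mathcal{I}_A^{odd}$ has no nonzero nilpotent elements, where $\mathcal{I}_A^{odd}$ is the ideal generated by $A_1$. A standard conjugation on $A$ is a map $a\mapsto\bar a$, and a graded conjugation on $A$ is a map $a\mapsto\tilde a$; both are additive, parity-preserving and satisfy respectively $\overline{\lambda a}=\bar\lambda\bar a$, $\overline{ab}=\bar a\bar b$, $\bar{\bar a}=a$, and $\widetilde{\lambda a}=\bar\lambda\tilde a$, $\widetilde{ab}=\tilde a\tilde b$, $\tilde{\tilde a}=(-1)^{|a|}a$ (for homogeneous $a$), with $\lambda\in\mathbb{C}$. Write $\hat a$ for the conjugate of $a$ in either case. $\mathcal{A}$ denotes the category of reduced, finitely generated superalgebras equipped with a conjugation (all standard when discussing standard real structures, all graded when discussing graded ones); morphisms are the superalgebra morphisms commuting with the conjugations. $\mathcal{S}$ is the category of sets. For a complex Lie superalgebra $V$, the functor $\mathcal{G}_V:\mathcal{A}\to\mathcal{S}$ is $\mathcal{G}_V(A)=(A\otimes_{\mathbb{C}}V)_0=A_0\otimes V_0\oplus A_1\otimes V_1$, with $\mathcal{G}_V(f)(a\otimes v)=f(a)\otimes v$ for a morphism $f$. Each $\mathcal{G}_V(A)$ is an $A_0$-module and a Lie algebra over $A_0$ with bracket $[a\otimes v,b\otimes w]_A=(-1)^{|b||v|}ab\otimes[v,w]$ for $|a|=|v|$,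 $|b|=|w|$. A real structure on $\mathcal{G}_V$ is a natural transformation $\Phi:\mathcal{G}_V\to\mathcal{G}_V$ such that for every $A$, all $a,b\in A_0$ and all $x,y\in\mathcal{G}_V(A)$: $\Phi_A(ax+by)=\hat a\Phi_A(x)+\hat b\Phi_A(y)$; $\Phi_A(\Phi_A(x))=x$; $\Phi_A([x,y]_A)=[\Phi_A(x),\Phi_A(y)]_A$; and $\Phi_A$ is even, i.e. it maps $A_0\otimes V_0$ to itself and $A_1\otimes V_1$ to itself. It is called standard (graded) when the conjugations are the standard (graded) ones.
   Formalization: In (2), standard case, φ is also assumed to preserve parity; without it the claim fails (V = C^{1|1} abelian, φ antilinear swapping the even and odd basis vectors), since ā⊗φ(v) must lie in (A⊗V)_0. *)

(* Defs.v *)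
From HB Require Import structures.
From mathcomp Require Import all_boot all_order all_algebra.
From mathcomp Require Import generic_quotient ring_quotient sesquilinear.
From mathcomp Require Import finmap monalg boolp.

Set Implicit Arguments.
Unset Strict Implicit.
Unset Printing Implicit Defensive.

Import GRing.Theory Num.Theory.
Local Open Scope quotient_scope.
Local Open Scope ring_scope.

(* The operations on tensor products are locked: unification would otherwise
   unfold them on every failing comparison. *)
Fact tens_key : unit. Proof. exact: tt. Qed.

Section TensorProduct.
Variables (F : comNzRingType) (A V : lmodType F).
Local Notation M := {malg F[(A * V)%type]}.

(* The submodule of the free module on A x V spanned by the bilinearity
   relations. *)
Definition tens_rel : {pred M} := fun x =>
  `[< forall S : {pred M}, submod_closed S ->
      (forall c a a' v,
        << (c *: a + a', v) >> - (c *: << (a, v) >> + << (a', v) >>) \in S) ->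
      (forall c a v v',
        << (a, c *: v + v') >> - (c *: << (a, v) >> + << (a, v') >>) \in S) ->
      x \in S >].

Fact tens_rel_submod : submod_closed tens_rel.
Proof.
split=> [|c x y /asboolP hx /asboolP hy]; apply/asboolP.
  by move=> S [].
move=> S hS h1 h2; have [_ hl] := hS.
by apply: hl; [apply: hx | apply: hy].
Qed.

HB.instance Definition _ := GRing.isSubmodClosed.Build F M tens_rel
  tens_rel_submod.

Definition tens : Type := Quotient.quot tens_rel.
HB.instance Definition _ := Choice.on tens.
HB.instance Definition _ := GRing.Zmodule.on tens.

Let pi_t (x : M) : tens := \pi_(Quotient.quot tens_rel) x.
Let repr_t (t : tens) : M := repr (t : Quotient.quot tens_rel).

Let pi_tK t : pi_t (repr_t t) = t.
Proof. exact: reprK. Qed.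

Let pi_tP x y : (pi_t x = pi_t y) <-> x - y \in tens_rel.
Proof.
by rewrite (Quotient.idealrBE tens_rel); split=> [h|/eqP h //]; apply/eqP.
Qed.

Let pi_tD x y : pi_t (x + y) = pi_t x + pi_t y.
Proof. exact: (raddfD (\pi_(Quotient.quot tens_rel))). Qed.

Definition tens_scale_def (c : F) (t : tens) : tens := pi_t (c *: repr_t t).
Definition tens_scale := locked_with tens_key tens_scale_def.

Let pi_tZ c x : pi_t (c *: x) = tens_scale c (pi_t x).
Proof.
rewrite /tens_scale unlock; apply/pi_tP; rewrite -scalerBr rpredZ //.
by apply/pi_tP; rewrite pi_tK.
Qed.

Fact tens_scalerA a b t : tens_scale a (tens_scale b t) = tens_scale (a * b) t.
Proof. by rewrite -[t]pi_tK -!pi_tZ scalerA. Qed.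
Fact tens_scale1r : left_id 1 tens_scale.
Proof. by move=> t; rewrite -[t]pi_tK -pi_tZ scale1r. Qed.
Fact tens_scalerDr : right_distributive tens_scale +%R.
Proof.
by move=> a t u; rewrite -[t]pi_tK -[u]pi_tK -pi_tD -!pi_tZ -pi_tD scalerDr.
Qed.
Fact tens_scalerDl t : {morph tens_scale^~ t : a b / a + b}.
Proof. by move=> a b /=; rewrite -[t]pi_tK -!pi_tZ -pi_tD scalerDl. Qed.

HB.instance Definition _ := GRing.Zmodule_isLmodule.Build F tens
  tens_scalerA tens_scale1r tens_scalerDr tens_scalerDl.

Definition pure_tens_def (a : A) (v : V) : tens := pi_t << (a, v) >>.
Definition pure_tens := locked_with tens_key pure_tens_def.

Let pure_tensE a v : pure_tens a v = pi_t << (a, v) >>.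
Proof. by rewrite /pure_tens unlock. Qed.

Lemma pure_tens_linearl v : linear (pure_tens^~ v).
Proof.
move=> c a a'; rewrite !pure_tensE -[c *: _ in RHS]pi_tZ -pi_tD; apply/pi_tP.
by apply/asboolP=> S _ h _; apply: h.
Qed.

Lemma pure_tens_linearr a : linear (pure_tens a).
Proof.
move=> c v v'; rewrite !pure_tensE -[c *: _ in RHS]pi_tZ -pi_tD; apply/pi_tP.
by apply/asboolP=> S _ _ h; apply: h.
Qed.

HB.instance Definition _ := bilinear_isBilinear.Build F A V tens *:%R *:%R
  pure_tens (pure_tens_linearl, pure_tens_linearr).

Section Lift.
Variables (W : lmodType F) (f : A -> V -> W).

Let mlift (x : M) : W := \sum_(k <- msupp x) x@_k *: f k.1 k.2.

(* The linear map induced by f; meaningful only when f is bilinear, see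
   tens_lift_pure. *)
Definition tens_lift_def (t : tens) : W := mlift (repr_t t).
Definition tens_lift := locked_with tens_key tens_lift_def.

Hypothesis f_linl : forall v, linear (f^~ v).
Hypothesis f_linr : forall a, linear (f a).

Let mliftE (d : {fset (A * V)%type}) x : (msupp x `<=` d)%fset ->
  mlift x = \sum_(k <- d) x@_k *: f k.1 k.2.
Proof.
move=> le; rewrite /mlift (big_fset_incl _ le) => //= k kd /mcoeff_outdom ->.
by rewrite scale0r.
Qed.

Let mlift_linear : linear mlift.
Proof.
move=> c x y; pose d := (msupp x `|` msupp y `|` msupp (c *: x + y))%fset.
rewrite !(@mliftE d) ?fsubsetUr //.
- rewrite scaler_sumr -big_split; apply: eq_bigr => k _ /=.
  by rewrite mcoeffD mcoeffZ scalerDl scalerA.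
- by rewrite /d fsubsetU // fsubsetUr.
- by rewrite /d fsubsetU // fsubsetUl.
Qed.

Let mliftU a v : mlift << (a, v) >> = f a v.
Proof.
by rewrite (mliftE msuppU_le) big_seq_fset1 mcoeffUU scale1r.
Qed.

Let mlift_rel x : x \in tens_rel -> mlift x = 0.
Proof.
have mliftN y z : mlift (y - z) = mlift y - mlift z.
  by have := mlift_linear (-1) z y; rewrite !scaleN1r !(addrC (- _)).
have h0 : mlift 0 = 0 by rewrite -(subrr 0) mliftN subrr.
move=> /asboolP /(_ [pred y | mlift y == 0]) h; apply/eqP; apply: h.
- split=> [|c y z]; rewrite !inE ?h0 //.
  by move=> /eqP hy /eqP hz; rewrite mlift_linear hy hz scaler0 addr0.
- move=> c a a' v; rewrite inE mliftN mlift_linear !mliftU f_linl subrr //.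
- move=> c a v v'; rewrite inE mliftN mlift_linear !mliftU f_linr subrr //.
Qed.

Let tens_lift_pi x : tens_lift (pi_t x) = mlift x.
Proof.
have -> : mlift x = mlift (1 *: repr_t (pi_t x) + (x - repr_t (pi_t x))).
  by rewrite scale1r addrC subrK.
rewrite mlift_linear scale1r /tens_lift unlock (@mlift_rel (_ - _)) ?addr0 //.
by apply/pi_tP; rewrite pi_tK.
Qed.

Lemma tens_lift_linear : linear tens_lift.
Proof.
move=> c t u; rewrite -[t]pi_tK -[u]pi_tK -[c *: _ in LHS]pi_tZ -pi_tD.
by rewrite !tens_lift_pi mlift_linear.
Qed.

Lemma tens_lift_pure a v : tens_lift (pure_tens a v) = f a v.
Proof. by rewrite pure_tensE tens_lift_pi mliftU. Qed.

End Lift.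

Lemma tens_sum_pure (t : tens) :
  exists s : seq (A * V), t = \sum_(p <- s) pure_tens p.1 p.2.
Proof.
exists [seq ((repr_t t)@_k *: k.1, k.2) | k <- msupp (repr_t t)].
rewrite big_map -[LHS]pi_tK [in LHS](monalgE (repr_t t)).
have pi_t0 : pi_t 0 = 0 by exact: raddf0 (\pi_(Quotient.quot tens_rel)).
rewrite (big_morph pi_t pi_tD pi_t0).
apply: eq_bigr => -[a v] _ /=; rewrite linearZl_LR /= pure_tensE.
rewrite -[RHS]pi_tZ; congr pi_t; apply/malgP => k.
by rewrite mcoeffZ !mcoeffU mulrnAr mulr1.
Qed.

Lemma tens_lift_sum (W : lmodType F) (f : A -> V -> W) (s : seq (A * V)) :
  (forall v, linear (f^~ v)) -> (forall a, linear (f a)) ->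
  tens_lift f (\sum_(p <- s) pure_tens p.1 p.2) = \sum_(p <- s) f p.1 p.2.
Proof.
move=> fl fr; have L := tens_lift_linear fl fr.
elim: s => [|p s IH].
  by have := L (-1) 0 0; rewrite !big_nil scaler0 addr0 scaleN1r addNr.
rewrite !big_cons -IH -(tens_lift_pure fl fr).
by have := L 1 (pure_tens p.1 p.2) (\sum_(q <- s) pure_tens q.1 q.2);
  rewrite !scale1r.
Qed.

Lemma tens_lift_comb (W : lmodType F) (f g h : A -> V -> W) c t :
  (forall v, linear (f^~ v)) -> (forall a, linear (f a)) ->
  (forall v, linear (g^~ v)) -> (forall a, linear (g a)) ->
  (forall v, linear (h^~ v)) -> (forall a, linear (h a)) ->
  (forall a v, f a v = c *: g a v + h a v) ->
  tens_lift f t = c *: tens_lift g t + tens_lift h t.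
Proof.
move=> f1 f2 g1 g2 h1 h2 e; have [s ->] := tens_sum_pure t.
rewrite !tens_lift_sum // scaler_sumr -big_split /=.
by apply: eq_bigr => p _; apply: e.
Qed.

End TensorProduct.

Notation "a ⊗ v" := (pure_tens a v) (at level 40, left associativity)
  : ring_scope.

Section Grading.
Variable F : comNzRingType.

(* A decomposition of V as the direct sum of an even part (index false) and an
   odd part (index true), given by the projections onto the two parts. *)
Record grading (V : lmodType F) := Grading {
  gpr : bool -> {linear V -> V};
  gpr_sum : forall x, gpr false x + gpr true x = x;
  gpr_gpr : forall i j x, gpr i (gpr j x) = if i == j then gpr j x else 0 }.

Definition homog (V : lmodType F) (g : grading V) (i : bool) : {pred V} :=
  [pred x | gpr g i x == x].

Section Theory.
Variables (V : lmodType F) (g : grading V).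

Fact homog_submod i : submod_closed (homog g i).
Proof.
split=> [|c x y]; rewrite !inE ?linear0 // => /eqP hx /eqP hy.
by rewrite linearP hx hy.
Qed.

HB.instance Definition _ i := GRing.isSubmodClosed.Build F V (homog g i)
  (homog_submod i).

Lemma gpr_homog i x : gpr g i x \in homog g i.
Proof. by rewrite inE gpr_gpr eqxx. Qed.

Lemma gpr_id i j x : x \in homog g i -> gpr g j x = if j == i then x else 0.
Proof. by rewrite inE => /eqP {1 2}<-; rewrite gpr_gpr. Qed.

End Theory.

Section TensorParity.
Variables (A V : lmodType F) (gA : grading A) (gV : grading V).

(* The subspace A_i ⊗ V_i of A ⊗ V. *)
Definition tens_part (i : bool) : {pred tens A V} := fun t =>
  `[< exists2 s : seq (A * V),
        all (fun p => (p.1 \in homog gA i) && (p.2 \in homog gV i)) s &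
        t = \sum_(p <- s) p.1 ⊗ p.2 >].

(* (A ⊗ V)_0 = A_0 ⊗ V_0 + A_1 ⊗ V_1. *)
Definition tens_even : {pred tens A V} := fun t =>
  `[< exists t0 t1, [/\ t0 \in tens_part false, t1 \in tens_part true
                      & t = t0 + t1] >].

Fact tens_part_submod i : submod_closed (tens_part i).
Proof.
split=> [|c t u]; first by apply/asboolP; exists [::]; rewrite ?big_nil.
move=> /asboolP[s hs ->] /asboolP[s' hs' ->]; apply/asboolP.
exists ([seq (c *: p.1, p.2) | p <- s] ++ s').
  rewrite all_cat hs' andbT all_map; apply: sub_all hs => p /= /andP[h1 h2].
  by rewrite rpredZ.
rewrite big_cat big_map scaler_sumr /=; congr (_ + _).
by apply: eq_bigr => p _; rewrite linearZl_LR.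
Qed.

HB.instance Definition _ i := GRing.isSubmodClosed.Build F (tens A V)
  (tens_part i) (tens_part_submod i).

Fact tens_even_submod : submod_closed tens_even.
Proof.
split=> [|c t u].
  by apply/asboolP; exists 0, 0; rewrite !rpred0 addr0.
move=> /asboolP[t0 [t1 [h0 h1 ->]]] /asboolP[u0 [u1 [k0 k1 ->]]].
apply/asboolP; exists (c *: t0 + u0), (c *: t1 + u1).
by rewrite !rpredD ?rpredZ // scalerDr addrACA.
Qed.

HB.instance Definition _ := GRing.isSubmodClosed.Build F (tens A V)
  tens_even tens_even_submod.

Lemma tens_part_pure i a v : a \in homog gA i -> v \in homog gV i ->
  a ⊗ v \in tens_part i.
Proof.
move=> ha hv; apply/asboolP; exists [:: (a, v)]; rewrite ?big_seq1 //=.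
by rewrite ha hv.
Qed.

Lemma tens_part_even i t : t \in tens_part i -> t \in tens_even.
Proof.
case: i => h; apply/asboolP; [exists 0, t | exists t, 0];
  by rewrite ?addr0 ?add0r ?rpred0.
Qed.

Lemma tens_even_ind (P : tens A V -> Prop) :
  P 0 -> (forall t u, P t -> P u -> P (t + u)) ->
  (forall i a v, a \in homog gA i -> v \in homog gV i -> P (a ⊗ v)) ->
  forall t, t \in tens_even -> P t.
Proof.
move=> P0 PD Pp t /asboolP[t0 [t1 [h0 h1 ->]]].
have hP i u : u \in tens_part i -> P u.
  move=> /asboolP[s hs ->]; rewrite big_seq; apply: big_ind => // p ps.
  by have /andP[] := allP hs _ ps; apply: Pp.
by apply: PD; [apply: hP h0 | apply: hP h1].
Qed.

End TensorParity.
End Grading.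

Section Superalgebra.
(* The field of complex numbers; _^* is its conjugation. *)
Variable C : numClosedFieldType.

Record superalg := Superalg {
  sa_alg :> algType C;
  sa_gr : grading sa_alg;
  sa_1 : 1 \in homog sa_gr false;
  sa_mul : forall i j (a b : sa_alg), a \in homog sa_gr i ->
    b \in homog sa_gr j -> a * b \in homog sa_gr (i (+) j);
  sa_comm : forall i j (a b : sa_alg), a \in homog sa_gr i ->
    b \in homog sa_gr j -> a * b = (-1) ^+ (i && j) * (b * a) }.

(* The two-sided ideal generated by A_1. *)
Definition odd_ideal (A : superalg) : {pred A} := fun x =>
  `[< forall S : {pred A}, zmod_closed S ->
        (forall a b, {in S, forall u, a * u * b \in S}) ->
        {subset homog (sa_gr A) true <= S} -> x \in S >].
Arguments odd_ideal : clear implicits.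

(* A / odd_ideal A has no nonzero nilpotent element. *)
Definition reduced (A : superalg) : Prop :=
  forall (a : A) n, a ^+ n \in odd_ideal A -> a \in odd_ideal A.

Definition fin_gen (A : superalg) : Prop :=
  exists s : seq A, forall S : {pred A},
    subalg_closed S -> {subset s <= S} -> forall a, a \in S.

Variant conj_kind := Standard | Graded.

(* The sign by which the square of a conjugation acts in parity i. *)
Definition conj_sign (k : conj_kind) (i : bool) : C :=
  if k is Graded then (-1) ^+ i else 1.

(* The objects and the morphisms of the category of reduced, finitely generated
   superalgebras with a conjugation. *)
Record csalg (k : conj_kind) := CSalg {
  cs_alg :> superalg;
  hat : cs_alg -> cs_alg;
  hatD : forall a b, hat (a + b) = hat a + hat b;
  hat_homog : forall i a, a \in homog (sa_gr cs_alg) i ->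
    hat a \in homog (sa_gr cs_alg) i;
  hatZ : forall (l : C) a, hat (l *: a) = l^* *: hat a;
  hatM : forall a b, hat (a * b) = hat a * hat b;
  hatK : forall i a, a \in homog (sa_gr cs_alg) i ->
    hat (hat a) = conj_sign k i *: a;
  cs_reduced : reduced cs_alg;
  cs_fin_gen : fin_gen cs_alg }.

Record csmorph (k : conj_kind) (A B : csalg k) := CSmorph {
  cm_fun :> {lrmorphism A -> B};
  cm_homog : forall i a, a \in homog (sa_gr A) i ->
    cm_fun a \in homog (sa_gr B) i;
  cm_hat : forall a, cm_fun (hat a) = hat (cm_fun a) }.

Record lieSuperalg := LieSuperalg {
  ls_mod :> lmodType C;
  ls_gr : grading ls_mod;
  ls_br : {bilinear ls_mod -> ls_mod -> ls_mod};
  ls_br_homog : forall i j x y, x \in homog ls_gr i -> y \in homog ls_gr j ->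
    ls_br x y \in homog ls_gr (i (+) j);
  ls_skew : forall i j x y, x \in homog ls_gr i -> y \in homog ls_gr j ->
    ls_br x y = - ((-1) ^+ (i && j) *: ls_br y x);
  ls_jacobi : forall i j x y z, x \in homog ls_gr i -> y \in homog ls_gr j ->
    ls_br x (ls_br y z) =
      ls_br (ls_br x y) z + (-1) ^+ (i && j) *: ls_br y (ls_br x z) }.

Section Functor.
Variables (k : conj_kind) (V : lieSuperalg).

Section Object.
Variable A : csalg k.

(* The value (A ⊗ V)_0 of the functor at A. *)
Record GV := MkGV {
  gval : tens A V;
  gvalP : gval \in tens_even (sa_gr A) (ls_gr V) }.

HB.instance Definition _ := [isSub for gval].
HB.instance Definition _ := [Choice of GV by <:].
HB.instance Definition _ := [SubChoice_isSubLmodule of GV by <:].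

Definition gpure i (a : A) (v : V) (ha : a \in homog (sa_gr A) i)
    (hv : v \in homog (ls_gr V) i) : GV :=
  MkGV (tens_part_even (tens_part_pure ha hv)).

(* b ⊗ v |-> (a * b) ⊗ v *)
Definition tens_act (a : A) (t : tens A V) : tens A V :=
  tens_lift (fun b v => (a * b) ⊗ v) t.

Let act_linl a (v : V) : linear (fun b : A => (a * b) ⊗ v).
Proof. by move=> c b b'; rewrite mulrDr -scalerAr linearPl. Qed.

Let act_linr a (b : A) : linear (fun v : V => (a * b) ⊗ v).
Proof. by move=> c v v'; rewrite linearPr. Qed.

Lemma tens_act_linear a : linear (tens_act a).
Proof. exact: tens_lift_linear. Qed.

Lemma tens_act_pure a b v : tens_act a (b ⊗ v) = (a * b) ⊗ v.
Proof. exact: tens_lift_pure. Qed.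

HB.instance Definition _ a := GRing.isLinear.Build C (tens A V) (tens A V)
  *:%R (tens_act a) (tens_act_linear a).

Fact tens_act_even a t : a \in homog (sa_gr A) false ->
  t \in tens_even (sa_gr A) (ls_gr V) ->
  tens_act a t \in tens_even (sa_gr A) (ls_gr V).
Proof.
move=> ha; elim/tens_even_ind => [|t' u ht hu|i b v hb hv].
- by rewrite linear0 rpred0.
- by rewrite linearD rpredD.
- rewrite tens_act_pure; apply: (tens_part_even (i := i)).
  by apply: tens_part_pure => //; apply: (sa_mul (i := false) (j := i)).
Qed.

(* The action of A_0 on (A ⊗ V)_0. *)
Definition gact (a : A) (ha : a \in homog (sa_gr A) false) (x : GV) : GV :=
  MkGV (tens_act_even ha (gvalP x)).

(* On homogeneous components this is
     [a ⊗ v, b ⊗ w] = (-1)^(|b||v|) (a * b) ⊗ [v, w];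
   i is the parity of b and j that of v. *)
Definition tens_br_pure (a : A) (v : V) (b : A) (w : V) : tens A V :=
  \sum_(i : bool) \sum_(j : bool) (-1) ^+ (i && j) *:
    ((a * gpr (sa_gr A) i b) ⊗ ls_br V (gpr (ls_gr V) j v) w).

Definition tens_br (t u : tens A V) : tens A V :=
  tens_lift (fun a v => tens_lift (tens_br_pure a v) u) t.

Let br_lin1 v b w : linear (fun a => tens_br_pure a v b w).
Proof.
move=> c a a'; rewrite /tens_br_pure !big_bool /=.
rewrite !mulrDl -!scalerAl !linearPl !scalerDr !scalerA !(mulrC c).
by rewrite [RHS]addrACA; congr (_ + _); rewrite addrACA.
Qed.

Let br_lin2 a b w : linear (fun v => tens_br_pure a v b w).
Proof.
move=> c v v'; rewrite /tens_br_pure !big_bool /=.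
rewrite !linearP !linearPl !linearPr !scalerDr !scalerA !(mulrC c).
by rewrite [RHS]addrACA; congr (_ + _); rewrite addrACA.
Qed.

Let br_lin3 a v w : linear (fun b => tens_br_pure a v b w).
Proof.
move=> c b b'; rewrite /tens_br_pure !big_bool /=.
rewrite !linearP !mulrDr -!scalerAr !linearPl !scalerDr !scalerA !(mulrC c).
by rewrite [RHS]addrACA; congr (_ + _); rewrite addrACA.
Qed.

Let br_lin4 a v b : linear (tens_br_pure a v b).
Proof.
move=> c w w'; rewrite /tens_br_pure !big_bool /=.
rewrite !linearPr !scalerDr !scalerA !(mulrC c).
by rewrite [RHS]addrACA; congr (_ + _); rewrite addrACA.
Qed.

Let br_linl u v : linear (fun a => tens_lift (tens_br_pure a v) u).
Proof. by move=> c a a'; apply: tens_lift_comb => // b w; apply: br_lin1. Qed.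

Let br_linr u a : linear (fun v => tens_lift (tens_br_pure a v) u).
Proof. by move=> c v v'; apply: tens_lift_comb => // b w; apply: br_lin2. Qed.

Lemma tens_br_linearl u : linear (tens_br^~ u).
Proof. exact: tens_lift_linear. Qed.

Lemma tens_br_linearr t : linear (tens_br t).
Proof.
move=> c u u'; apply: tens_lift_comb => // a v.
exact: tens_lift_linear.
Qed.

HB.instance Definition _ := bilinear_isBilinear.Build C _ _ _ *:%R *:%R
  tens_br (tens_br_linearl, tens_br_linearr).

Lemma tens_br_homog i j a v b w :
  v \in homog (ls_gr V) i -> b \in homog (sa_gr A) j ->
  tens_br (a ⊗ v) (b ⊗ w) = (-1) ^+ (j && i) *: ((a * b) ⊗ ls_br V v w).
Proof.
move=> hv hb; rewrite /tens_br !tens_lift_pure // /tens_br_pure !big_bool /=.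
rewrite !(gpr_id _ hv) !(gpr_id _ hb).
by case: i {hv} j {hb} => -[] /=;
  rewrite ?mulr0 ?linear0l ?linear0r ?scaler0 ?linear0l ?addr0 ?add0r.
Qed.

Fact tens_br_even t u : t \in tens_even (sa_gr A) (ls_gr V) ->
  u \in tens_even (sa_gr A) (ls_gr V) ->
  tens_br t u \in tens_even (sa_gr A) (ls_gr V).
Proof.
move=> ht hu; elim/tens_even_ind: ht => [|t1 t2 h1 h2|i a v ha hv].
- by rewrite linear0l rpred0.
- by rewrite linearDl rpredD.
elim/tens_even_ind: hu => [|u1 u2 h1 h2|j b w hb hw].
- by rewrite linear0r rpred0.
- by rewrite linearDr rpredD.
rewrite (tens_br_homog _ _ hv hb) rpredZ //.
apply: (tens_part_even (i := i (+) j)).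
by apply: tens_part_pure; [apply: sa_mul | apply: ls_br_homog].
Qed.

(* The Lie bracket of (A ⊗ V)_0. *)
Definition gbr (x y : GV) : GV := MkGV (tens_br_even (gvalP x) (gvalP y)).

End Object.

Section Morphism.
Variables (A B : csalg k) (f : csmorph A B).

(* a ⊗ v |-> f a ⊗ v *)
Definition tens_map (t : tens A V) : tens B V :=
  tens_lift (fun a v => f a ⊗ v) t.

Let map_linl (v : V) : linear (fun a : A => f a ⊗ v).
Proof. by move=> c a a'; rewrite linearP linearPl. Qed.

Let map_linr (a : A) : linear (fun v : V => f a ⊗ v).
Proof. by move=> c v v'; rewrite linearPr. Qed.

Lemma tens_map_linear : linear tens_map.
Proof. exact: tens_lift_linear. Qed.

Lemma tens_map_pure a v : tens_map (a ⊗ v) = f a ⊗ v.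
Proof. exact: tens_lift_pure. Qed.

HB.instance Definition _ := GRing.isLinear.Build C (tens A V) (tens B V)
  *:%R tens_map tens_map_linear.

Fact tens_map_even t : t \in tens_even (sa_gr A) (ls_gr V) ->
  tens_map t \in tens_even (sa_gr B) (ls_gr V).
Proof.
elim/tens_even_ind => [|t' u ht hu|i a v ha hv].
- by rewrite linear0 rpred0.
- by rewrite linearD rpredD.
- rewrite tens_map_pure; apply: (tens_part_even (i := i)).
  by apply: tens_part_pure => //; apply: cm_homog.
Qed.

(* The value of the functor at f. *)
Definition gmap (x : GV A) : GV B := MkGV (tens_map_even (gvalP x)).

End Morphism.

Record real_structure (Phi : forall A : csalg k, GV A -> GV A) : Prop := {
  rs_natural : forall (A B : csalg k) (f : csmorph A B) x,
    Phi B (gmap f x) = gmap f (Phi A x);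
  rs_antilinear : forall (A : csalg k) (a b : A)
      (ha : a \in homog (sa_gr A) false) (hb : b \in homog (sa_gr A) false) x y,
    Phi A (gact ha x + gact hb y) =
      gact (hat_homog ha) (Phi A x) + gact (hat_homog hb) (Phi A y);
  rs_involutive : forall A x, Phi A (Phi A x) = x;
  rs_bracket : forall A x y, Phi A (gbr x y) = gbr (Phi A x) (Phi A y);
  rs_even : forall (A : csalg k) i x,
    gval x \in tens_part (sa_gr A) (ls_gr V) i ->
    gval (Phi A x) \in tens_part (sa_gr A) (ls_gr V) i }.

Definition comes_from (Phi : forall A : csalg k, GV A -> GV A)
    (phi : V -> V) : Prop :=
  forall (A : csalg k) i (a : A) (v : V) (ha : a \in homog (sa_gr A) i)
    (hv : v \in homog (ls_gr V) i),
  gval (Phi A (gpure ha hv)) = hat a ⊗ phi v.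

End Functor.

Section Maps.
Variables (V : lieSuperalg) (phi : V -> V).

Definition antilinear_map : Prop := forall (l m : C) (x y : V),
  phi (l *: x + m *: y) = l^* *: phi x + m^* *: phi y.

Definition bracket_map : Prop := forall x y : V,
  phi (ls_br V x y) = ls_br V (phi x) (phi y).

(* Without it hat a ⊗ phi v need not lie in (A ⊗ V)_0; a graded_map has this
   property, see graded_map_even. *)
Definition even_map : Prop := forall i (x : V),
  x \in homog (ls_gr V) i -> phi x \in homog (ls_gr V) i.

Definition standard_map : Prop :=
  [/\ antilinear_map, forall x, phi (phi x) = x & bracket_map].

Definition graded_map : Prop :=
  [/\ antilinear_map,
      forall i x, x \in homog (ls_gr V) i -> phi (phi x) = (-1) ^+ i *: x
    & bracket_map].

Lemma graded_map_even : graded_map -> even_map.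
Proof.
move=> [lin sq _] i x hx; set y := phi x; pose g := ls_gr V.
have phiZ (l : C) z : phi (l *: z) = l^* *: phi z.
  by have := lin l 0 z 0; rewrite conjC0 !scale0r !addr0.
have phiD z z' : phi (z + z') = phi z + phi z'.
  by have := lin 1 1 z z'; rewrite conjC1 !scale1r.
have h1 : phi (phi y) = (-1) ^+ i *: y.
  by rewrite [phi y](sq i x hx) phiZ rmorphXn rmorphN1.
have h2 : phi (phi y) = gpr g false y - gpr g true y.
  rewrite -{1}(gpr_sum g y) !phiD !(sq _ _ (gpr_homog g _ y)).
  by rewrite expr0 expr1 scale1r scaleN1r.
have h3 j : (-1) ^+ i *: gpr g j y = (-1) ^+ j *: gpr g j y :> V.
  rewrite -linearZ /= -h1 h2 linearB /= !gpr_gpr.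
  by case: j => /=; rewrite ?sub0r ?subr0 ?expr1 ?expr0 ?scaleN1r ?scale1r.
have h4 : gpr g (~~ i) y = 0.
  have : gpr g (~~ i) y = - gpr g (~~ i) y.
    by have := h3 (~~ i); case: i {hx h1 h3} => /=;
      rewrite expr0 expr1 scale1r scaleN1r.
  move/eqP; rewrite -addr_eq0 -mulr2n -scaler_nat scaler_eq0 pnatr_eq0.
  by move/eqP.
by rewrite inE -{2}(gpr_sum g y); case: i {hx h1 h3} h4 => /= ->;
  rewrite ?add0r ?addr0.
Qed.

End Maps.
End Superalgebra.

(* Main.v *)
Require Import Defs.
From mathcomp Require Import all_boot all_order all_algebra.
From mathcomp Require Import complex boolp reals.
From HB Require Import structures.
From mathcomp Require Import ring.

(** A real structure is determined by its value at one object, the Grassmann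
algebra on two odd generators θ1, θ2 with the conjugation θ1 |-> θ2 |-> s θ1,
where s = 1 in the standard case and s = -1 in the graded one.  This object is
free on one odd element: for every A in the category and every odd a in A there
is a morphism [gr_eval_cs] to A with θ1 |-> a and θ2 |-> hat a.  In the graded
case a single generator would not do, because hat θ = λ θ gives
hat (hat θ) = |λ|^2 θ, which is not - θ; with two generators both kinds of
conjugation get the same proof.

Let Φ be a real structure.  For v even, naturality along the endomorphism
that kills θ1 and θ2 forces Φ(1 ⊗ v) = 1 ⊗ φ v ([Phi_one]), and then
A_0-antilinearity gives Φ_A(a ⊗ v) = hat a ⊗ φ v for a even.  For v odd, Φ
being even gives Φ(θ1 ⊗ v) = θ1 ⊗ w1 + θ2 ⊗ w2.  Computing Φ('i θ1 ⊗ v) once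
by naturality along θ1 |-> 'i θ1 and once by antilinearity yields
'i w1 = - 'i w1, so that w1 = 0 ([Phi_theta1]); hence φ v := w2 satisfies
Φ_A(a ⊗ v) = hat a ⊗ φ v for every odd a, by naturality along θ1 |-> a.  Thus
Φ comes from φ ([Phi_comes_from]).  The three identities for φ and its
uniqueness follow by reading the axioms of Φ on tensors whose Grassmann factor
is nonzero; for the bracket of two odd elements these are θ1 ⊗ x and θ2 ⊗ y,
because θ1 θ2 is not 0 ([base_map_conj_map], [comes_from_unique]).

Conversely a ⊗ v |-> hat a ⊗ φ v is antilinear in both arguments, hence
induces an antilinear map on A ⊗ V, and the axioms are checked on pure tensors
([gconj_real_structure]).

Both kinds of conjugation are treated at once by [conj_map], which asks for
φ (φ x) = s_i x on x of parity i, where s_i = [conj_sign C k i]. *)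

Set Implicit Arguments.
Unset Strict Implicit.
Unset Printing Implicit Defensive.
Import GRing.Theory Num.Theory.
Local Open Scope ring_scope.

(** * The Grassmann algebra on two odd generators *)

(** The coordinates on the basis 1, θ1 θ2, θ1, θ2.  This is a record and not a
product of copies of C, which unification could unfold to a type that carries
the componentwise multiplication. *)
Record grass (C : numClosedFieldType) : Type :=
  Grass { gr0 : C; gr12 : C; gr1 : C; gr2 : C }.

Section Grassmann.
Variable C : numClosedFieldType.
Local Notation L := (grass C).

Lemma gr_ext (x y : L) : gr0 x = gr0 y -> gr12 x = gr12 y -> gr1 x = gr1 y ->
  gr2 x = gr2 y -> x = y.
Proof. by case: x y => [? ? ? ?] [? ? ? ?] /= -> -> -> ->. Qed.

Let code (x : L) := (gr0 x, gr12 x, gr1 x, gr2 x).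
Let decode (p : C * C * C * C) : L := Grass p.1.1.1 p.1.1.2 p.1.2 p.2.
Fact grass_codeK : cancel code decode. Proof. by case. Qed.
HB.instance Definition _ := Choice.copy L (can_type grass_codeK).

Definition gradd (x y : L) : L :=
  Grass (gr0 x + gr0 y) (gr12 x + gr12 y) (gr1 x + gr1 y) (gr2 x + gr2 y).
Definition gropp (x : L) : L :=
  Grass (- gr0 x) (- gr12 x) (- gr1 x) (- gr2 x).
Definition grscale (c : C) (x : L) : L :=
  Grass (c * gr0 x) (c * gr12 x) (c * gr1 x) (c * gr2 x).
Definition grmul (x y : L) : L :=
  Grass (gr0 x * gr0 y)
        (gr0 x * gr12 y + gr12 x * gr0 y + gr1 x * gr2 y - gr2 x * gr1 y)
        (gr0 x * gr1 y + gr1 x * gr0 y)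
        (gr0 x * gr2 y + gr2 x * gr0 y).

Fact graddA : associative gradd.
Proof. by move=> x y z; apply: gr_ext; rewrite /= addrA. Qed.
Fact graddC : commutative gradd.
Proof. by move=> x y; apply: gr_ext; rewrite /= addrC. Qed.
Fact gradd0 : left_id (Grass 0 0 0 0) gradd.
Proof. by move=> x; apply: gr_ext; rewrite /= add0r. Qed.
Fact graddN : left_inverse (Grass 0 0 0 0) gropp gradd.
Proof. by move=> x; apply: gr_ext; rewrite /= addNr. Qed.
HB.instance Definition _ := GRing.isZmodule.Build L graddA graddC gradd0 graddN.

Lemma gr_add (x y : L) : (gr0 (x + y) = gr0 x + gr0 y) *
  (gr12 (x + y) = gr12 x + gr12 y) * (gr1 (x + y) = gr1 x + gr1 y) *
  (gr2 (x + y) = gr2 x + gr2 y).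
Proof. by []. Qed.

Lemma gr_zero : (gr0 (0 : L) = 0) * (gr12 (0 : L) = 0) * (gr1 (0 : L) = 0) *
  (gr2 (0 : L) = 0).
Proof. by []. Qed.

Fact grscaleA a b x : grscale a (grscale b x) = grscale (a * b) x.
Proof. by apply: gr_ext; rewrite /= mulrA. Qed.
Fact grscale1 : left_id 1 grscale.
Proof. by move=> x; apply: gr_ext; rewrite /= mul1r. Qed.
Fact grscaleDr : right_distributive grscale +%R.
Proof. by move=> a x y; apply: gr_ext; rewrite /= mulrDr. Qed.
Fact grscaleDl x : {morph grscale^~ x : a b / a + b}.
Proof. by move=> a b; apply: gr_ext; rewrite /= mulrDl. Qed.
HB.instance Definition _ := GRing.Zmodule_isLmodule.Build C L
  grscaleA grscale1 grscaleDr grscaleDl.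

Lemma gr_scale (c : C) (x : L) : (gr0 (c *: x) = c * gr0 x) *
  (gr12 (c *: x) = c * gr12 x) * (gr1 (c *: x) = c * gr1 x) *
  (gr2 (c *: x) = c * gr2 x).
Proof. by []. Qed.

Lemma gr_mk (a b c d : C) : (gr0 (Grass a b c d) = a) *
  (gr12 (Grass a b c d) = b) * (gr1 (Grass a b c d) = c) *
  (gr2 (Grass a b c d) = d).
Proof. by []. Qed.

Fact grmulA : associative grmul.
Proof. by move=> x y z; apply: gr_ext; rewrite !gr_mk; ring. Qed.
Fact grmul1 : left_id (Grass 1 0 0 0) grmul.
Proof. by move=> x; apply: gr_ext; rewrite !gr_mk; ring. Qed.
Fact grmulr1 : right_id (Grass 1 0 0 0) grmul.
Proof. by move=> x; apply: gr_ext; rewrite !gr_mk; ring. Qed.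
Fact grmulDl : left_distributive grmul +%R.
Proof. by move=> x y z; apply: gr_ext; rewrite !(gr_mk, gr_add); ring. Qed.
Fact grmulDr : right_distributive grmul +%R.
Proof. by move=> x y z; apply: gr_ext; rewrite !(gr_mk, gr_add); ring. Qed.
Fact gr1_neq0 : Grass 1 0 0 0 != 0.
Proof. by apply/eqP => /(congr1 (@gr0 C)) /eqP; rewrite oner_eq0. Qed.

HB.instance Definition _ := GRing.Zmodule_isNzRing.Build L
  grmulA grmul1 grmulr1 grmulDl grmulDr gr1_neq0.

Lemma gr_one : (gr0 (1 : L) = 1) * (gr12 (1 : L) = 0) * (gr1 (1 : L) = 0) *
  (gr2 (1 : L) = 0).
Proof. by []. Qed.

Lemma gr_mul (x y : L) : (gr0 (x * y) = gr0 x * gr0 y) *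
  (gr12 (x * y) =
    gr0 x * gr12 y + gr12 x * gr0 y + gr1 x * gr2 y - gr2 x * gr1 y) *
  (gr1 (x * y) = gr0 x * gr1 y + gr1 x * gr0 y) *
  (gr2 (x * y) = gr0 x * gr2 y + gr2 x * gr0 y).
Proof. by []. Qed.

Definition grE := (gr_mk, gr_add, gr_zero, gr_scale, gr_one, gr_mul).

Fact grscaleAl (c : C) (x y : L) : c *: (x * y) = c *: x * y.
Proof. by apply: gr_ext; rewrite !grE; ring. Qed.
HB.instance Definition _ := GRing.Lmodule_isLalgebra.Build C L grscaleAl.
Fact grscaleAr (c : C) (x y : L) : c *: (x * y) = x * (c *: y).
Proof. by apply: gr_ext; rewrite !grE; ring. Qed.
HB.instance Definition _ := GRing.Lalgebra_isAlgebra.Build C L grscaleAr.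

Definition grpart (i : bool) (x : L) : L :=
  if i then Grass 0 0 (gr1 x) (gr2 x) else Grass (gr0 x) (gr12 x) 0 0.
Fact grpart_linear i : linear (grpart i).
Proof. by case: i => c x y; apply: gr_ext; rewrite /grpart !grE //; ring. Qed.
HB.instance Definition _ i := GRing.isLinear.Build C L L *:%R (grpart i)
  (grpart_linear i).
Fact grpart_sum x : grpart false x + grpart true x = x.
Proof. by apply: gr_ext; rewrite !grE; ring. Qed.
Fact grpart_idem i j x :
  grpart i (grpart j x) = if i == j then grpart j x else 0.
Proof. by case: i j => -[]; apply: gr_ext. Qed.

Definition grass_grading : grading L :=
  @Grading C L (fun i => grpart i) grpart_sum grpart_idem.

Lemma grass_even x : x \in homog grass_grading false ->
  (gr1 x = 0) * (gr2 x = 0).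
Proof. by rewrite inE => /eqP /= <-. Qed.
Lemma grass_odd x : x \in homog grass_grading true ->
  (gr0 x = 0) * (gr12 x = 0).
Proof. by rewrite inE => /eqP /= <-. Qed.

Lemma Grass_even_homog a b : Grass a b 0 0 \in homog grass_grading false.
Proof. by rewrite inE. Qed.
Lemma Grass_odd_homog a b : Grass 0 0 a b \in homog grass_grading true.
Proof. by rewrite inE. Qed.

Fact grass_1 : 1 \in homog grass_grading false.
Proof. exact: Grass_even_homog. Qed.

Fact grass_mul i j (a b : L) : a \in homog grass_grading i ->
    b \in homog grass_grading j -> a * b \in homog grass_grading (i (+) j).
Proof.
case: i j => -[] /=; (move=> /grass_odd ha || move=> /grass_even ha);
  (move=> /grass_odd hb || move=> /grass_even hb);
  by rewrite inE; apply/eqP/gr_ext;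
     rewrite /grpart /= ?ha ?hb ?mul0r ?mulr0 ?addr0 ?subr0.
Qed.

Fact grass_comm i j (a b : L) : a \in homog grass_grading i ->
    b \in homog grass_grading j -> a * b = (-1) ^+ (i && j) * (b * a).
Proof.
case: i j => -[] /=; (move=> /grass_odd ha || move=> /grass_even ha);
  (move=> /grass_odd hb || move=> /grass_even hb);
  rewrite ?expr0 ?expr1 ?mulN1r ?mul1r -1?scaleN1r;
  by apply: gr_ext; rewrite !grE ?ha ?hb; ring.
Qed.

Definition grass_superalg : superalg C :=
  @Superalg C L grass_grading grass_1 grass_mul grass_comm.

Definition theta1 : L := Grass 0 0 1 0.
Definition theta2 : L := Grass 0 0 0 1.

Lemma grass_basis x :
  x = gr0 x *: 1 + gr12 x *: (theta1 * theta2) + gr1 x *: theta1 +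
      gr2 x *: theta2.
Proof. by apply: gr_ext; rewrite !grE; ring. Qed.

(** The ideal generated by θ1 and θ2 contains θ1 θ2 as well, so the reduced
algebra is the field of scalars. *)
Lemma grass_odd_ideal x : (x \in @odd_ideal C grass_superalg) = (gr0 x == 0).
Proof.
apply/idP/eqP.
  move/asboolP => /(_ [pred y | gr0 y == 0]) h; apply/eqP; apply: h.
  - split=> [|y z]; rewrite !inE //= => /eqP hy /eqP hz.
    by rewrite hy hz subr0.
  - by move=> a b y; rewrite !inE /= => /eqP->; rewrite mulr0 mul0r.
  - by move=> y /grass_odd h; rewrite inE h.
move=> h; apply/asboolP => S [S0 SB] Sm So.
have SD y z : y \in S -> z \in S -> y + z \in S.
  by move=> hy hz; rewrite -[z]opprK SB // -sub0r SB.
have sub c d : Grass 0 0 c d \in S by apply: So; apply: Grass_odd_homog.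
have -> : x = 1 * Grass 0 0 (gr12 x) 0 * theta2 + Grass 0 0 (gr1 x) (gr2 x).
  by apply: gr_ext; rewrite !grE ?h; ring.
by apply: SD => //; apply: Sm.
Qed.

Lemma grass_reduced : reduced grass_superalg.
Proof.
move=> a n; rewrite !grass_odd_ideal.
have -> : gr0 (a ^+ n) = gr0 a ^+ n.
  by elim: n => [|n IH]; rewrite ?expr0 // !exprS grE IH.
by rewrite expf_eq0 => /andP[].
Qed.

Lemma grass_fin_gen : fin_gen grass_superalg.
Proof.
exists [:: theta1; theta2] => S [S1 SL SM] hs a.
have h1 : theta1 \in S by apply: hs; rewrite inE eqxx.
have h2 : theta2 \in S by apply: hs; rewrite !inE eqxx orbT.
have S0 : 0 \in S by have := SL (-1) _ _ S1 S1; rewrite scaleN1r addNr.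
have -> : a = gr0 a *: 1 + (gr12 a *: (theta1 * theta2) +
    (gr1 a *: theta1 + (gr2 a *: theta2 + 0))).
  by rewrite addr0 !addrA -grass_basis.
apply: (SL) => //; apply: (SL); first exact: SM.
by do 2! apply: (SL) => //.
Qed.

Variable k : conj_kind.
Local Notation s := (@conj_sign C k true).

Lemma conj_sign0 : conj_sign C k false = 1.
Proof. by case: (k). Qed.

Lemma conj_sign_conj i : (conj_sign C k i)^* = conj_sign C k i.
Proof. by rewrite /conj_sign; case: k; rewrite ?conjC1 // rmorphXn rmorphN1. Qed.

Lemma conj_sign_sqr i : conj_sign C k i * conj_sign C k i = 1.
Proof.
by rewrite /conj_sign; case: k; case: i; rewrite ?expr0 ?expr1 ?mulrNN mulr1.
Qed.

Lemma conj_sign_neq0 i : conj_sign C k i != 0.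
Proof.
apply: contra_eq_neq (conj_sign_sqr i) => ->.
by rewrite mul0r eq_sym oner_eq0.
Qed.

(** The conjugation with θ1 |-> θ2 |-> s θ1; being multiplicative it maps
θ1 θ2 to θ2 (s θ1) = - s θ1 θ2. *)
Definition grhat (x : L) : L :=
  Grass (gr0 x)^* (- s * (gr12 x)^*) (s * (gr2 x)^*) (gr1 x)^*.

Fact grhatD a b : grhat (a + b) = grhat a + grhat b.
Proof. by apply: gr_ext; rewrite /grhat !grE !rmorphD; ring. Qed.
Fact grhatZ (l : C) a : grhat (l *: a) = l^* *: grhat a.
Proof. by apply: gr_ext; rewrite /grhat !grE !rmorphM; ring. Qed.
Fact grhatM a b : grhat (a * b) = grhat a * grhat b.
Proof.
by apply: gr_ext; rewrite /grhat !grE !(rmorphM, rmorphD, rmorphN); ring.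
Qed.
Fact grhat_homog i a : a \in homog grass_grading i ->
  grhat a \in homog grass_grading i.
Proof.
case: i; (move=> /grass_odd ha || move=> /grass_even ha);
  rewrite inE /= /grpart; apply/eqP/gr_ext;
  rewrite /grhat !grE ?ha ?rmorph0; ring.
Qed.
Fact grhatK i a : a \in homog grass_grading i ->
  grhat (grhat a) = conj_sign C k i *: a.
Proof.
case: i; (move=> /grass_odd ha || move=> /grass_even ha);
  apply: gr_ext; rewrite /grhat !grE ?ha ?(rmorphM, rmorphN) /=.
all: by rewrite ?conj_sign_conj ?rmorph0 ?mulr0 ?conjCK ?conj_sign0 ?mul1r //
  mulrA mulrNN conj_sign_sqr mul1r.
Qed.

Definition grass_cs : csalg C k :=
  @CSalg C k grass_superalg grhat grhatD grhat_homog grhatZ grhatM grhatK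
    grass_reduced grass_fin_gen.
End Grassmann.

(** * Morphisms out of the Grassmann algebra *)

Section Evaluation.
Variables (C : numClosedFieldType) (k : conj_kind) (A : csalg C k).
Local Notation s := (conj_sign C k true).

(** A multiplicative map fixes 1 once 1 is a value of it. *)
Lemma hat1 : hat (1 : A) = 1.
Proof.
have hh : hat (hat (1 : A)) = 1.
  by rewrite (hatK (sa_1 A)) conj_sign0 scale1r.
by rewrite -[LHS]mul1r -{1}hh -hatM mulr1 hh.
Qed.

Lemma odd_anticomm (a b : A) : a \in homog (sa_gr A) true ->
  b \in homog (sa_gr A) true -> a * b = - (b * a).
Proof. by move=> ha hb; rewrite (sa_comm ha hb) expr1 mulN1r. Qed.

Lemma odd_sqr (a : A) : a \in homog (sa_gr A) true -> a * a = 0.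
Proof.
move=> ha; have /eqP := odd_anticomm ha ha.
by rewrite -addr_eq0 -mulr2n -scaler_nat scaler_eq0 pnatr_eq0 => /eqP.
Qed.

(** The images of the basis under the morphism with θ1 |-> a and θ2 |-> hat a.
The proof that a is odd is an argument so that the morphism structures below,
which depend on it, are inferred from the function. *)
Definition gr_eval (a : A) (ha : a \in homog (sa_gr A) true)
    (x : grass C) : A :=
  gr0 x *: 1 + gr12 x *: (a * hat a) + gr1 x *: a + gr2 x *: hat a.

Section Eval.
Variables (a : A) (ha : a \in homog (sa_gr A) true).
Local Notation ev := (gr_eval ha).

Fact gr_eval_linear : linear ev.
Proof.
move=> c x y; rewrite /gr_eval !grE !scalerDl -!scalerA !scalerDr.
by do 2! [rewrite [RHS]addrACA; congr (_ + _)]; rewrite [RHS]addrACA.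
Qed.
HB.instance Definition _ := GRing.isLinear.Build C (grass C) A *:%R ev
  gr_eval_linear.

Fact gr_eval_monoid : monoid_morphism ev.
Proof.
split; first by rewrite /gr_eval !grE !scale0r scale1r !addr0.
have hb := hat_homog ha.
have e1 := odd_sqr ha; have e2 := odd_sqr hb.
have e3 : hat a * a = - (a * hat a) by apply: odd_anticomm.
have e4 : a * hat a * a = 0 by rewrite -mulrA e3 mulrN mulrA e1 mul0r oppr0.
have e5 : a * hat a * hat a = 0 by rewrite -mulrA e2 mulr0.
have e6 : a * (a * hat a) = 0 by rewrite mulrA e1 mul0r.
have e7 : hat a * (a * hat a) = 0 by rewrite mulrA e3 mulNr e5 oppr0.
have e8 : a * hat a * (a * hat a) = 0 by rewrite mulrA e4 mul0r.
move=> x y; rewrite /gr_eval.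
rewrite !mulrDl !mulrDr -!scalerAl -!scalerAr !mul1r !mulr1 !scalerA.
rewrite !(e1, e2, e3, e4, e5, e6, e7, e8) !scaler0 !addr0 scalerN -scaleNr.
rewrite !grE !scalerDl.
(* Collect the terms in 1, a * hat a, a and hat a. *)
by rewrite [RHS](AC (5*2*2) (1*(2*5*7*9)*(3*6)*(4*8)))%AC.
Qed.
HB.instance Definition _ := GRing.isMonoidMorphism.Build (grass C) A ev
  gr_eval_monoid.

Fact gr_eval_homog i x : x \in homog (sa_gr (grass_cs C k)) i ->
  ev x \in homog (sa_gr A) i.
Proof.
have hb := hat_homog ha; have h2 := sa_mul ha hb.
rewrite /gr_eval; case: i => [/grass_odd|/grass_even] e; rewrite !e !scale0r.
  by rewrite !add0r rpredD ?rpredZ.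
by rewrite !addr0 rpredD ?rpredZ // sa_1.
Qed.

Fact gr_eval_hat (x : grass_cs C k) : ev (hat x) = hat (ev x).
Proof.
rewrite /gr_eval /= !hatD !hatZ hatM hat1 (hatK ha) /=.
rewrite -scalerAr (odd_anticomm (hat_homog ha) ha) !scalerN !scalerA.
by rewrite [RHS]addrAC mulNr scaleNr !(mulrC s).
Qed.

Definition gr_eval_cs : csmorph (grass_cs C k) A :=
  @CSmorph C k (grass_cs C k) A ev gr_eval_homog gr_eval_hat.

Lemma gr_eval_theta1 : gr_eval_cs (theta1 C) = a.
Proof.
by rewrite /= /gr_eval !gr_mk !scale0r scale1r addr0 !add0r.
Qed.

Lemma gr_eval_theta2 : gr_eval_cs (theta2 C) = hat a.
Proof.
by rewrite /= /gr_eval !gr_mk !scale0r scale1r !add0r.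
Qed.

Lemma gr_eval_theta12 : gr_eval_cs (theta1 C * theta2 C) = a * hat a.
Proof.
by rewrite rmorphM; congr (_ * _);
  [exact: gr_eval_theta1 | exact: gr_eval_theta2].
Qed.

End Eval.
End Evaluation.

(** * Coefficients of tensors *)

Section TensorCoefficient.
Variables (C : numClosedFieldType) (A V : lmodType C).

Section Coef.
Variable c : {linear A -> C^o}.

Definition tens_coef (t : tens A V) : V :=
  tens_lift (fun a v => (c a : C) *: v) t.

Let coef_linl (v : V) : linear (fun a : A => (c a : C) *: v).
Proof. by move=> l a a'; rewrite linearP scalerDl scalerA. Qed.

Let coef_linr (a : A) : linear (fun v : V => (c a : C) *: v).
Proof. by move=> l v v'; rewrite scalerDr !scalerA mulrC. Qed.

Fact tens_coef_linear : linear tens_coef.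
Proof. exact: tens_lift_linear. Qed.
HB.instance Definition _ := GRing.isLinear.Build C (tens A V) V *:%R tens_coef
  tens_coef_linear.

Lemma tens_coef_pure a v : tens_coef (a ⊗ v) = (c a : C) *: v.
Proof. exact: tens_lift_pure. Qed.

Lemma pure_tens_inj a (v v' : V) : c a != 0 -> a ⊗ v = a ⊗ v' -> v = v'.
Proof.
move=> ca /(congr1 tens_coef); rewrite !tens_coef_pure.
exact: scalerI.
Qed.

Lemma tens_coef_homog (gA : grading A) (gV : grading V) i t :
  t \in tens_part gA gV i -> tens_coef t \in homog gV i.
Proof.
move=> /asboolP[l hl ->]; rewrite linear_sum /= big_seq rpred_sum // => p pl.
by have /andP[_ h] := allP hl _ pl; rewrite tens_coef_pure rpredZ.
Qed.

Lemma tens_coef_part0 (gA : grading A) (gV : grading V) i t :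
  {in homog gA i, forall a, c a = 0} -> t \in tens_part gA gV i ->
  tens_coef t = 0.
Proof.
move=> hc /asboolP[l hl ->]; rewrite linear_sum /= big_seq big1 // => p pl.
by have /andP[h _] := allP hl _ pl; rewrite tens_coef_pure hc // scale0r.
Qed.
End Coef.
End TensorCoefficient.

Section GrassTens.
Variable C : numClosedFieldType.
Local Notation L := (grass C).

Fact gr0_linear : linear (@gr0 C : L -> C^o). Proof. by []. Qed.
HB.instance Definition _ := GRing.isLinear.Build C L C^o *:%R (@gr0 C)
  gr0_linear.
Fact gr12_linear : linear (@gr12 C : L -> C^o). Proof. by []. Qed.
HB.instance Definition _ := GRing.isLinear.Build C L C^o *:%R (@gr12 C)
  gr12_linear.
Fact gr1_linear : linear (@gr1 C : L -> C^o). Proof. by []. Qed.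
HB.instance Definition _ := GRing.isLinear.Build C L C^o *:%R (@gr1 C)
  gr1_linear.
Fact gr2_linear : linear (@gr2 C : L -> C^o). Proof. by []. Qed.
HB.instance Definition _ := GRing.isLinear.Build C L C^o *:%R (@gr2 C)
  gr2_linear.

Variable V : lieSuperalg C.

Lemma tens_grass (t : tens L V) :
  t = 1 ⊗ tens_coef (@gr0 C) t +
      (theta1 C * theta2 C) ⊗ tens_coef (@gr12 C) t +
      theta1 C ⊗ tens_coef (@gr1 C) t + theta2 C ⊗ tens_coef (@gr2 C) t.
Proof.
have [l ->] := tens_sum_pure t.
rewrite !linear_sum /= !linear_sumr -!big_split; apply: eq_bigr => -[a v] _ /=.
by rewrite !tens_coef_pure !linearZr_LR -!linearZl_LR -!linearDl -grass_basis.
Qed.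

Lemma tens_grass_even (t : tens L V) :
  t \in tens_part (grass_grading C) (ls_gr V) false ->
  t = 1 ⊗ tens_coef (@gr0 C) t +
      (theta1 C * theta2 C) ⊗ tens_coef (@gr12 C) t.
Proof.
move=> ht; rewrite {1}[t]tens_grass.
rewrite (@tens_coef_part0 _ _ _ (@gr1 C) _ _ _ _ _ ht); last first.
  by move=> a /grass_even h /=; rewrite h.
rewrite (@tens_coef_part0 _ _ _ (@gr2 C) _ _ _ _ _ ht); last first.
  by move=> a /grass_even h /=; rewrite h.
by rewrite !linear0r !addr0.
Qed.

Lemma tens_grass_odd (t : tens L V) :
  t \in tens_part (grass_grading C) (ls_gr V) true ->
  t = theta1 C ⊗ tens_coef (@gr1 C) t + theta2 C ⊗ tens_coef (@gr2 C) t.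
Proof.
move=> ht; rewrite {1}[t]tens_grass.
rewrite (@tens_coef_part0 _ _ _ (@gr0 C) _ _ _ _ _ ht); last first.
  by move=> a /grass_odd h /=; rewrite h.
rewrite (@tens_coef_part0 _ _ _ (@gr12 C) _ _ _ _ _ ht); last first.
  by move=> a /grass_odd h /=; rewrite h.
by rewrite !linear0r !add0r.
Qed.
End GrassTens.

(** * Antilinear maps of a Lie superalgebra *)

Section ConjMaps.
Variables (C : numClosedFieldType) (V : lieSuperalg C) (k : conj_kind).

(** A standard map for k = Standard, see [conj_map_standard], and by definition
a graded map for k = Graded. *)
Definition conj_map (phi : V -> V) : Prop :=
  [/\ antilinear_map phi,
      forall i x, x \in homog (ls_gr V) i -> phi (phi x) = conj_sign C k i *: x
    & bracket_map phi].

Section Anti.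
Variables (phi : V -> V) (phi_anti : antilinear_map phi).

Lemma antilinearD x y : phi (x + y) = phi x + phi y.
Proof. by have := phi_anti 1 1 x y; rewrite conjC1 !scale1r. Qed.

Lemma antilinearZ c x : phi (c *: x) = c^* *: phi x.
Proof. by have := phi_anti c 0 x 0; rewrite conjC0 !scale0r !addr0. Qed.

Lemma antilinear_parts x :
  phi x = phi (gpr (ls_gr V) false x) + phi (gpr (ls_gr V) true x).
Proof. by rewrite -antilinearD gpr_sum. Qed.

End Anti.

Lemma antilinear_bracket (phi : V -> V) : antilinear_map phi ->
  (forall i j x y, x \in homog (ls_gr V) i -> y \in homog (ls_gr V) j ->
    phi (ls_br V x y) = ls_br V (phi x) (phi y)) ->
  bracket_map phi.
Proof.
move=> lin h x y.
rewrite -(gpr_sum (ls_gr V) x) -(gpr_sum (ls_gr V) y).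
rewrite !(linearDl, linearDr, antilinearD lin) /=.
by rewrite !(h _ _ _ _ (gpr_homog _ _ _) (gpr_homog _ _ _)).
Qed.
End ConjMaps.

Lemma conj_map_standard (C : numClosedFieldType) (V : lieSuperalg C)
    (phi : V -> V) : conj_map Standard phi <-> standard_map phi.
Proof.
split=> -[lin sq br]; split=> //; last by move=> i x _; rewrite sq scale1r.
move=> x.
have := antilinearD lin; rewrite -{2}(gpr_sum (ls_gr V) x) => D.
by rewrite (antilinear_parts lin x) D !(sq _ _ (gpr_homog _ _ _)) !scale1r.
Qed.

(** * The map underlying a real structure *)

Section FunctorValues.
Variables (C : numClosedFieldType) (V : lieSuperalg C) (k : conj_kind).

(** The equality is a hypothesis, and not substituted, for the sake of
a = hat (c%:A), which is a scalar only up to a rewriting that ha would block. *)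
Lemma gact_scale (A : csalg C k) (c : C) (a : A)
    (ha : a \in homog (sa_gr A) false) (x : GV V A) :
  a = c%:A -> gact ha x = c *: x.
Proof.
move=> e; apply: val_inj; case: x => t ht.
change (tens_act a t = c *: t); rewrite e.
have [l ->] := tens_sum_pure t; rewrite linear_sum scaler_sumr.
by apply: eq_bigr => p _; rewrite /= tens_act_pure mulr_algl linearZl_LR.
Qed.

Lemma gmap_gpure (A B : csalg C k) (f : csmorph A B) i (a : A) (v : V)
    (ha : a \in homog (sa_gr A) i) (hv : v \in homog (ls_gr V) i) (b : B)
    (hb : b \in homog (sa_gr B) i) :
  f a = b -> gmap f (gpure ha hv) = gpure hb hv.
Proof. by move=> e; apply: val_inj; rewrite /= tens_map_pure e. Qed.

End FunctorValues.

Section FromStructure.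
Variables (C : numClosedFieldType) (V : lieSuperalg C) (k : conj_kind).
Variable (Phi : forall A : csalg C k, GV V A -> GV V A).
Hypothesis Phi_rs : real_structure Phi.
Local Notation G := (grass_cs C k).
Local Notation gV := (ls_gr V).

Lemma Phi_linear (A : csalg C k) (c d : C) (x y : GV V A) :
  Phi (c *: x + d *: y) = c^* *: Phi x + d^* *: Phi y.
Proof.
have hs (e : C) : e%:A \in homog (sa_gr A) false by rewrite rpredZ // sa_1.
have E e (z : GV V A) : gact (hs e) z = e *: z.
  exact: (gact_scale (hs e) z erefl).
have E' e (z : GV V A) : gact (hat_homog (hs e)) z = e^* *: z.
  by apply: gact_scale; rewrite hatZ hat1.
by have := rs_antilinear Phi_rs (hs c) (hs d) x y; rewrite !E !E'.
Qed.

Lemma PhiZ (A : csalg C k) (c : C) (x : GV V A) : Phi (c *: x) = c^* *: Phi x.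
Proof. by have := Phi_linear c 0 x 0; rewrite conjC0 !scale0r !addr0. Qed.

(** The element of parity i on which Φ is to be evaluated, and below it the
coordinate that extracts w from hat (gen i) ⊗ w. *)
Definition gen (i : bool) : G := if i then theta1 C else 1.

Lemma gen_homog i : gen i \in homog (sa_gr G) i.
Proof. by case: i; [exact: Grass_odd_homog | exact: grass_1]. Qed.

Definition gen_coef (i : bool) (x : grass C) : C :=
  if i then gr2 x else gr0 x.

Fact gen_coef_linear i : linear (gen_coef i : grass C -> C^o).
Proof. by case: i. Qed.
HB.instance Definition _ i := GRing.isLinear.Build C (grass C) C^o *:%R
  (gen_coef i) (gen_coef_linear i).

Lemma gen_coef_hat i : gen_coef i (hat (gen i)) = 1.
Proof. by case: i; rewrite /= conjC1. Qed.

Definition gen_part i v : GV V G := gpure (gen_homog i) (gpr_homog gV i v).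

Lemma gen_part_linear i c d v w :
  gen_part i (c *: v + d *: w) = c *: gen_part i v + d *: gen_part i w.
Proof.
apply: val_inj; change (gen i ⊗ gpr gV i (c *: v + d *: w) =
  c *: (gen i ⊗ gpr gV i v) + d *: (gen i ⊗ gpr gV i w)).
by rewrite linearD !linearZ /= linearDr !linearZr_LR.
Qed.

(** The candidate for φ, read off from Φ(1 ⊗ v0) and Φ(θ1 ⊗ v1), where v0 and
v1 are the components of v. *)
Definition base_map (v : V) : V :=
  tens_coef (gen_coef false) (gval (Phi (gen_part false v))) +
  tens_coef (gen_coef true) (gval (Phi (gen_part true v))).

Lemma gval_lin (A : csalg C k) (c d : C) (x y : GV V A) :
  gval (c *: x + d *: y) = c *: gval x + d *: gval y.
Proof. by []. Qed.

Lemma base_map_antilinear : antilinear_map base_map.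
Proof.
move=> c d x y; rewrite /base_map !gen_part_linear !Phi_linear !gval_lin.
by rewrite !linearD !linearZ /= addrACA.
Qed.

Lemma base_map_homogE i v : v \in homog gV i ->
  base_map v = tens_coef (gen_coef i) (gval (Phi (gen_part i v))).
Proof.
move=> hv.
have z : gen_part (~~ i) v = 0.
  apply: val_inj; rewrite /= (gpr_id _ hv).
  by case: (i) => /=; rewrite linear0r.
have pz : Phi (gen_part (~~ i) v) = 0.
  by have := PhiZ 0 (gen_part (~~ i) v); rewrite conjC0 !scale0r z.
by rewrite /base_map; case: i {hv z} pz => /= ->; rewrite linear0 ?addr0 ?add0r.
Qed.

Lemma Phi_gen_part_part i v :
  gval (Phi (gen_part i v)) \in tens_part (sa_gr G) gV i.
Proof.
apply: (rs_even Phi_rs).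
by apply: tens_part_pure; [exact: gen_homog | exact: gpr_homog].
Qed.

Lemma base_map_even : even_map base_map.
Proof.
move=> i x hx; rewrite (base_map_homogE hx).
exact: tens_coef_homog (Phi_gen_part_part i x).
Qed.

Lemma gpure_gen_part i v (hv : v \in homog gV i) :
  gpure (gen_homog i) hv = gen_part i v.
Proof. by apply: val_inj; rewrite /= (gpr_id _ hv) eqxx. Qed.

(** Evenness leaves a possible term in θ1 θ2.  Naturality along the endomorphism
that sends θ1 to 0 fixes 1 ⊗ v and removes this term. *)
Lemma Phi_one v : v \in homog gV false ->
  gval (Phi (gen_part false v)) = 1 ⊗ base_map v.
Proof.
move=> hv; rewrite (base_map_homogE hv).
set x := gen_part false v; set t := gval (Phi x).
have ht : t \in tens_part (sa_gr G) gV false by exact: Phi_gen_part_part.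
have h0 : (0 : G) \in homog (sa_gr G) true by rewrite rpred0.
have fx : gmap (gr_eval_cs h0) x = x by apply: gmap_gpure; rewrite rmorph1.
have E : t = tens_map (gr_eval_cs h0) t.
  by rewrite /t -{1}fx (rs_natural Phi_rs).
rewrite {1}E {1}(tens_grass_even ht) linearD /= !tens_map_pure.
by rewrite rmorph1 gr_eval_theta12 mul0r linear0l addr0.
Qed.

(** The term in θ1 that evenness allows vanishes, because naturality along
θ1 |-> 'i θ1 multiplies it by 'i and antilinearity by - 'i. *)
Lemma Phi_theta1 v : v \in homog gV true ->
  gval (Phi (gen_part true v)) = theta2 C ⊗ base_map v.
Proof.
move=> hv; rewrite (base_map_homogE hv).
set x := gen_part true v; set t := gval (Phi x).
have ht : t \in tens_part (sa_gr G) gV true by exact: Phi_gen_part_part.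
have hi : ('i *: theta1 C : G) \in homog (sa_gr G) true.
  by rewrite rpredZ // (gen_homog true).
have fx : gmap (gr_eval_cs hi) x = 'i *: x.
  apply: val_inj.
  change (tens_map (gr_eval_cs hi) (theta1 C ⊗ gpr gV true v) =
    'i *: (theta1 C ⊗ gpr gV true v)).
  by rewrite tens_map_pure gr_eval_theta1 linearZl_LR.
have E : 'i^* *: t = tens_map (gr_eval_cs hi) t.
  change (gval ('i^* *: Phi x) = gval (gmap (gr_eval_cs hi) (Phi x))).
  by rewrite -PhiZ -fx (rs_natural Phi_rs).
have w1 : tens_coef (@gr1 C) t = 0.
  have := congr1 (tens_coef (@gr1 C)) E.
  rewrite {2}(tens_grass_odd ht) linearD /= !tens_map_pure.
  rewrite gr_eval_theta1 gr_eval_theta2 linearZ linearD /= !tens_coef_pure /=.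
  rewrite conjCi mulr1 mulr0 conjC0 mulr0 scale0r addr0.
  move/eqP; rewrite -subr_eq0 -scalerBl scaler_eq0 -opprD oppr_eq0 -mulr2n.
  by rewrite mulrn_eq0 /= (negPf (neq0Ci _)) => /eqP.
by rewrite {1}(tens_grass_odd ht) w1 linear0r add0r.
Qed.

Lemma Phi_gen i v : v \in homog gV i ->
  gval (Phi (gen_part i v)) = hat (gen i) ⊗ base_map v.
Proof.
case: i => hv; last by rewrite Phi_one // hat1.
rewrite Phi_theta1 //; congr (_ ⊗ _).
by apply: gr_ext; rewrite /= ?conjC0 ?conjC1 ?mulr0.
Qed.

(** An odd a is the image of θ1, so that naturality applies; an even a is a
multiple of the image of 1, so that A_0-antilinearity applies. *)
Lemma Phi_comes_from : comes_from Phi base_map.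
Proof.
move=> A [] a v ha hv.
  have <- := gmap_gpure (gen_homog true) hv ha (gr_eval_theta1 ha).
  rewrite (rs_natural Phi_rs) gpure_gen_part /= Phi_gen // tens_map_pure.
  by rewrite cm_hat gr_eval_theta1.
have h0 : (0 : A) \in homog (sa_gr A) true by rewrite rpred0.
pose f := gr_eval_cs h0.
(* Any morphism to A will do here, since only the image of 1 matters. *)
have -> : gpure ha hv = gact ha (gmap f (gpure (gen_homog false) hv)).
  by apply: val_inj; rewrite /= tens_map_pure tens_act_pure rmorph1 mulr1.
set y := gmap _ _.
have g0 (b : A) (hb : b \in homog (sa_gr A) false) : gact hb 0 = 0 :> GV V A.
  by apply: val_inj; rewrite /= linear0.
have Phi0 : Phi (0 : GV V A) = 0.
  by have := PhiZ 0 (0 : GV V A); rewrite conjC0 !scale0r.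
have := rs_antilinear Phi_rs ha ha y 0; rewrite Phi0 !g0 !addr0 => ->.
rewrite /= /y (rs_natural Phi_rs) gpure_gen_part /= Phi_gen // hat1.
by rewrite tens_map_pure rmorph1 tens_act_pure mulr1.
Qed.

Lemma gen_inj i (v w : V) : hat (gen i) ⊗ v = hat (gen i) ⊗ w -> v = w.
Proof.
apply: (@pure_tens_inj _ _ _ (gen_coef i)).
by rewrite [X in X != _](gen_coef_hat i) oner_eq0.
Qed.

(** Starting from hat (gen i) instead of gen i makes both sides tensors over
hat (gen i), since the third conjugate is a multiple of the first. *)
Lemma base_map_sqr i v : v \in homog gV i ->
  base_map (base_map v) = conj_sign C k i *: v.
Proof.
move=> hv; have hg := hat_homog (gen_homog i).
have hw := base_map_even hv.
have e1 : Phi (gpure hg hv) = gpure (hat_homog hg) hw.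
  by apply: val_inj; apply: Phi_comes_from.
have e2 : hat (hat (hat (gen i))) ⊗ base_map (base_map v) = hat (gen i) ⊗ v.
  by rewrite -(Phi_comes_from (hat_homog hg) hw) -e1 (rs_involutive Phi_rs).
rewrite (hatK hg) linearZl_LR -linearZr_LR in e2.
by rewrite -{2}(gen_inj e2) scalerA conj_sign_sqr scale1r.
Qed.

(** The second odd generator is θ2, as the square of hat θ1 is 0. *)
Lemma gen_pair i j : exists c : {linear grass C -> C^o},
  c (hat (gen i) * hat ((if j then theta2 C else 1) : G)) != 0.
Proof.
case: i j => -[];
  [exists (@gr12 C) | exists (@gr2 C) | exists (@gr1 C) | exists (@gr0 C)].
all: rewrite /= !(conjC0, conjC1, mulr0, mul0r, mulr1, mul1r, add0r, addr0).
all: rewrite ?(sub0r, oppr0).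
all: by rewrite ?oppr_eq0 ?oner_eq0 // conj_sign_neq0.
Qed.

Lemma base_map_bracket i j x y : x \in homog gV i -> y \in homog gV j ->
  base_map (ls_br V x y) = ls_br V (base_map x) (base_map y).
Proof.
move=> hx hy.
pose b : G := if j then theta2 C else 1.
have ha := gen_homog i.
have hb : b \in homog (sa_gr G) j.
  by rewrite /b; case: (j); [exact: Grass_odd_homog | exact: grass_1].
have e : gbr (gpure ha hx) (gpure hb hy) =
    (-1) ^+ (j && i) *: gpure (sa_mul ha hb) (ls_br_homog hx hy).
  apply: val_inj; exact: (tens_br_homog _ _ hx hb).
have := congr1 (@gval _ _ _ _) (rs_bracket Phi_rs (gpure ha hx) (gpure hb hy)).
rewrite e PhiZ /= !Phi_comes_from.
rewrite (tens_br_homog _ _ (base_map_even hx) (hat_homog hb)).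
rewrite hatM rmorphXn rmorphN1.
have sgn_neq0 : (-1) ^+ (j && i) != 0 :> C by rewrite signr_eq0.
move/(scalerI sgn_neq0); have [c hc] := gen_pair i j.
exact: pure_tens_inj hc.
Qed.

Lemma base_map_conj_map : conj_map k base_map.
Proof.
have lin := base_map_antilinear.
split; [exact: lin | exact: base_map_sqr |].
exact: antilinear_bracket base_map_bracket.
Qed.

Lemma comes_from_unique psi : comes_from Phi psi -> antilinear_map psi ->
  base_map =1 psi.
Proof.
move=> hpsi lin v.
rewrite (antilinear_parts lin) (antilinear_parts base_map_antilinear).
have h i w : w \in homog gV i -> base_map w = psi w.
  move=> hw; apply: (@gen_inj i).
  by rewrite -Phi_gen // -(gpure_gen_part hw) hpsi.
by rewrite !(h _ _ (gpr_homog _ _ _)).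
Qed.

End FromStructure.

(** * The real structure induced by a map *)

(** The conjugate module: an antilinear map to W is a linear map to it, which
lets the universal property of the tensor product apply to antilinear maps. *)
Definition conj_mod (C : numClosedFieldType) (W : lmodType C) : Type := W.

Section ConjMod.
Variables (C : numClosedFieldType) (W : lmodType C).

HB.instance Definition _ := GRing.Zmodule.copy (conj_mod W) W.
Definition conj_scale (c : C) (w : conj_mod W) : conj_mod W := c^* *: (w : W).
Fact conj_scaleA a b w : conj_scale a (conj_scale b w) = conj_scale (a * b) w.
Proof. by rewrite /conj_scale scalerA rmorphM. Qed.
Fact conj_scale1 : left_id 1 conj_scale.
Proof. by move=> w; rewrite /conj_scale conjC1 scale1r. Qed.
Fact conj_scaleDr : right_distributive conj_scale +%R.
Proof. by move=> c v w; apply: scalerDr. Qed.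
Fact conj_scaleDl w : {morph conj_scale^~ w : a b / a + b}.
Proof. by move=> a b; rewrite /conj_scale rmorphD scalerDl. Qed.
HB.instance Definition _ := GRing.Zmodule_isLmodule.Build C (conj_mod W)
  conj_scaleA conj_scale1 conj_scaleDr conj_scaleDl.

End ConjMod.

Section ToStructure.
Variables (C : numClosedFieldType) (V : lieSuperalg C) (k : conj_kind).
Variable phi : V -> V.
Hypotheses (phi_even : even_map phi) (phi_conj : conj_map k phi).
Let phi_anti : antilinear_map phi. Proof. by case: phi_conj. Qed.

Section Obj.
Variable A : csalg C k.

Definition tens_conj (t : tens A V) : tens A V :=
  @tens_lift C A V (conj_mod (tens A V)) (fun a v => hat a ⊗ phi v) t.

Let conj_linl (v : V) :
  linear ((fun a : A => hat a ⊗ phi v) : A -> conj_mod (tens A V)).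
Proof. by move=> c a a'; rewrite hatD hatZ linearPl. Qed.

Let conj_linr (a : A) :
  linear ((fun v : V => hat a ⊗ phi v) : V -> conj_mod (tens A V)).
Proof.
move=> c v v'.
by rewrite (antilinearD phi_anti) (antilinearZ phi_anti) linearPr.
Qed.

Lemma tens_conjP c t u :
  tens_conj (c *: t + u) = c^* *: tens_conj t + tens_conj u.
Proof. exact: (@tens_lift_linear C A V (conj_mod (tens A V))). Qed.

Lemma tens_conjD t u : tens_conj (t + u) = tens_conj t + tens_conj u.
Proof. by have := tens_conjP 1 t u; rewrite conjC1 !scale1r. Qed.

Lemma tens_conj0 : tens_conj 0 = 0.
Proof.
have := tens_conjP (-1) 0 0.
by rewrite rmorphN1 !scaleN1r oppr0 addr0 addNr.
Qed.

Lemma tens_conjZ c t : tens_conj (c *: t) = c^* *: tens_conj t.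
Proof. by have := tens_conjP c t 0; rewrite tens_conj0 !addr0. Qed.

Lemma tens_conj_pure a v : tens_conj (a ⊗ v) = hat a ⊗ phi v.
Proof. exact: (@tens_lift_pure C A V (conj_mod (tens A V))). Qed.

Lemma tens_conj_sum (I : Type) (r : seq I) (F : I -> tens A V) :
  tens_conj (\sum_(i <- r) F i) = \sum_(i <- r) tens_conj (F i).
Proof. exact: (big_morph _ tens_conjD tens_conj0). Qed.

Lemma tens_conj_part i t : t \in tens_part (sa_gr A) (ls_gr V) i ->
  tens_conj t \in tens_part (sa_gr A) (ls_gr V) i.
Proof.
move=> /asboolP[l hl ->]; rewrite tens_conj_sum big_seq rpred_sum // => p pl.
have /andP[h1 h2] := allP hl _ pl; rewrite tens_conj_pure.
by apply: tens_part_pure; [exact: hat_homog | exact: phi_even].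
Qed.

Lemma tens_conj_even t : t \in tens_even (sa_gr A) (ls_gr V) ->
  tens_conj t \in tens_even (sa_gr A) (ls_gr V).
Proof.
move=> /asboolP[t0 [t1 [h0 h1 ->]]].
rewrite tens_conjD rpredD //.
  exact: tens_part_even (tens_conj_part h0).
exact: tens_part_even (tens_conj_part h1).
Qed.

Definition gconj (x : GV V A) : GV V A := MkGV (tens_conj_even (gvalP x)).

Lemma tens_conj_act (a : A) t :
  tens_conj (tens_act a t) = tens_act (hat a) (tens_conj t).
Proof.
have [l ->] := tens_sum_pure t; rewrite linear_sum !tens_conj_sum linear_sum /=.
apply: eq_bigr => p _.
by rewrite tens_act_pure !tens_conj_pure tens_act_pure hatM.
Qed.

(** The two signs, one from the conjugation of A and one from phi, cancel
because a and v have the same parity; hence the restriction to even tensors. *)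
Lemma tens_conjK t : t \in tens_even (sa_gr A) (ls_gr V) ->
  tens_conj (tens_conj t) = t.
Proof.
have [_ sq _] := phi_conj.
elim/tens_even_ind => [|t' u ht hu|i a v ha hv]; first by rewrite !tens_conj0.
  by rewrite !tens_conjD ht hu.
rewrite !tens_conj_pure (hatK ha) (sq _ _ hv).
by rewrite linearZl_LR linearZr_LR /= scalerA conj_sign_sqr scale1r.
Qed.

Lemma tens_conj_br t u : t \in tens_even (sa_gr A) (ls_gr V) ->
  u \in tens_even (sa_gr A) (ls_gr V) ->
  tens_conj (tens_br t u) = tens_br (tens_conj t) (tens_conj u).
Proof.
have [_ _ br] := phi_conj; move=> ht hu.
elim/tens_even_ind: ht => [|t1 t2 h1 h2|i a v ha hv].
- by rewrite !(linear0l, tens_conj0).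
- by rewrite !(linearDl, tens_conjD) h1 h2.
elim/tens_even_ind: hu => [|u1 u2 h1 h2|j b w hb hw].
- by rewrite !(linear0r, tens_conj0).
- by rewrite linearDr !tens_conjD linearDr h1 h2.
rewrite (tens_br_homog _ _ hv hb) tens_conjZ !tens_conj_pure.
rewrite (tens_br_homog _ _ (phi_even hv) (hat_homog hb)).
by rewrite hatM br rmorphXn rmorphN1.
Qed.

End Obj.

Lemma gconj_real_structure : real_structure gconj.
Proof.
split.
- move=> A B f [t ht]; apply: val_inj; rewrite /= {ht}.
  have [l ->] := tens_sum_pure t; rewrite linear_sum !tens_conj_sum linear_sum.
  apply: eq_bigr => p _.
  by rewrite /= tens_map_pure !tens_conj_pure tens_map_pure cm_hat.
- move=> A a b ha hb x y; apply: val_inj.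
  change (tens_conj (tens_act a (gval x) + tens_act b (gval y)) =
    tens_act (hat a) (tens_conj (gval x)) +
    tens_act (hat b) (tens_conj (gval y))).
  by rewrite tens_conjD !tens_conj_act.
- by move=> A x; apply: val_inj; apply: tens_conjK; apply: gvalP.
- by move=> A x y; apply: val_inj; apply: tens_conj_br; apply: gvalP.
- by move=> A i x; apply: tens_conj_part.
Qed.

Lemma gconj_comes_from : comes_from gconj phi.
Proof. by move=> A i a v ha hv; apply: tens_conj_pure. Qed.

End ToStructure.

(** * The correspondence *)

Lemma conj_map_of_structure (C : numClosedFieldType) (V : lieSuperalg C)
    (k : conj_kind) (Phi : forall A : csalg C k, GV V A -> GV V A) :
  real_structure Phi ->
  exists2 phi : V -> V, even_map phi &
    unique (fun psi => comes_from Phi psi /\ conj_map k psi) phi.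
Proof.
move=> rs; exists (base_map Phi); first exact: base_map_even.
split; first by split; [exact: Phi_comes_from | exact: base_map_conj_map].
move=> psi [hpsi [lin _ _]]; apply: funext; exact: comes_from_unique.
Qed.

Lemma structure_of_conj_map (C : numClosedFieldType) (V : lieSuperalg C)
    (k : conj_kind) (phi : V -> V) : even_map phi -> conj_map k phi ->
  exists2 Phi : forall A : csalg C k, GV V A -> GV V A,
    real_structure Phi & comes_from Phi phi.
Proof.
move=> ev cj; exists (gconj ev cj).
  exact: gconj_real_structure.
exact: gconj_comes_from.
Qed.

Theorem theorem2p1 (R : realType) (V : lieSuperalg R[i]) :
  (forall Phi : forall A : csalg R[i] Standard, GV V A -> GV V A,
     real_structure Phi ->
     exists2 phi : V -> V, even_map phi &
       unique (fun psi => comes_from Phi psi /\ standard_map psi) phi) /\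
  (forall Phi : forall A : csalg R[i] Graded, GV V A -> GV V A,
     real_structure Phi ->
     exists2 phi : V -> V, even_map phi &
       unique (fun psi => comes_from Phi psi /\ graded_map psi) phi) /\
  (forall phi : V -> V, even_map phi -> standard_map phi ->
     exists2 Phi : forall A : csalg R[i] Standard, GV V A -> GV V A,
       real_structure Phi & comes_from Phi phi) /\
  (forall phi : V -> V, graded_map phi ->
     exists2 Phi : forall A : csalg R[i] Graded, GV V A -> GV V A,
       real_structure Phi & comes_from Phi phi).
Proof.
split=> [Phi /conj_map_of_structure [phi ev [[cf cj] un]]|].
  exists phi => //; split; first by split=> //; apply/conj_map_standard.
  by move=> psi [? /conj_map_standard ?]; apply: un.
split=> [Phi|]; first exact: conj_map_of_structure.
split=> phi.
  by move=> ev /conj_map_standard; apply: structure_of_conj_map.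
by move=> gr; apply: structure_of_conj_map => //; apply: graded_map_even.
Qed.
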